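(* Let $\mathcal{R}$ be a commutative ring with unity, let $A$ and $B$ be two unital $\mathcal{R}$-algebras and $M$ a unital $(A,B)$-bimodule. Let $\mathcal{S}=\mathrm{Tri}(A;M;B)$ and let $\mathcal{N}$ be a unital $\mathcal{S}$-bimodule. The following assertions are equivalent. (1) The trivial extension algebra $\mathcal{S}\ltimes\mathcal{N}$ has a triangular matrix representation. (2) There exists a nontrivial idempotent $e=(e_a,e_b)\in A\times B$ such that $(1-e_a)Ae_a=0$, $(1-e_b)Be_b=0$, $(1-e_a)Me_b=0$ and $(1-e)\mathcal{N}e=0$. In particular, if in addition $A$ and $B$ have only trivial idempotents, then the idempotent $e$ in assertion (2) is necessarily $(1,0)$.
   Context: For unital $\mathcal{R}$-algebras $A,B$ and a unital $(A,B)$-bimodule $M$, the triangular matrix algebra $\mathrm{Tri}(A;M;B)$ is the $\mathcal{R}$-algebra of matrices $\begin{pmatrix} a & m\\ 0 & b\end{pmatrix}$ ($a\in A$, $m\in M$, $b\in B$) with the usual matrix operations. An element $(a,b)\in A\times B$ is identified with the diagonal matrix $\begin{pmatrix} a & 0\\ 0 & b\end{pmatrix}\in\mathcal{S}$; this gives the meaning of $(1-e)\mathcal{N}e$. The trivial extension algebra $\mathcal{S}\ltimes\mathcal{N}$ is $\mathcal{S}\times\mathcal{N}$ with componentwise addition and scalar multiplication and product $(s,n)(s',n')=(ss',sn'+ns')$. An algebra has a triangular matrix representation if it is isomorphic, as an $\mathcal{R}$-algebra, to some triangular matrix algebra $\mathrm{Tri}(A';M';B')$ with $A'$ and $B'$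 nonzero. An idempotent $e$ is nontrivial if $e\neq 0,1$; an algebra has only trivial idempotents if $0$ and $1$ are its only idempotents.
   Formalization: The final assertion (e is necessarily (1,0)) is proved under the additional hypothesis M ≠ 0; without it the assertion is false, e.g. for A = B = R a field, M = 0, N = 0, where e = (0,1) also satisfies (2). *)

(* Defs.v *)
From HB Require Import structures.
From mathcomp Require Import all_boot all_algebra.

Set Implicit Arguments.
Unset Strict Implicit.
Unset Printing Implicit Defensive.

Import GRing.Theory.
Local Open Scope ring_scope.

(* Unital associative R-algebras.  MathComp's algType R forces 1 != 0 in the
   carrier; the structure below has the same axioms but allows the zero
   algebra.  It has its own scaling because HB does not accept a new join of
   pzRingType and lmodType R below GRing.LSemiAlgebra. *)
HB.mixin Record PzRing_isPzAlgebra (R : comPzRingType) A of GRing.PzRing A := {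
  ascale : R -> A -> A;
  ascaleA : forall (j k : R) (x : A), ascale j (ascale k x) = ascale (j * k) x;
  ascale1 : forall x : A, ascale 1 x = x;
  ascaleDr : forall (k : R) (x y : A), ascale k (x + y) = ascale k x + ascale k y;
  ascaleDl : forall (j k : R) (x : A), ascale (j + k) x = ascale j x + ascale k x;
  ascaleAl : forall (k : R) (x y : A), ascale k (x * y) = ascale k x * y;
  ascaleAr : forall (k : R) (x y : A), ascale k (x * y) = x * ascale k y
}.

#[short(type="pzAlgType")]
HB.structure Definition PzAlgebra (R : comPzRingType) :=
  {A of GRing.PzRing A & PzRing_isPzAlgebra R A}.

HB.instance Definition _ (R : comPzRingType) (A : algType R) :=
  PzRing_isPzAlgebra.Build R A (@scalerA R A) (@scale1r R A) (@scalerDr R A)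
    (fun j k x => scalerDl x j k) (@scalerAl R A) (@scalerAr R A).

(* Unital (A, B)-bimodules over R: the R-module structures induced by the left
   action of A and by the right action of B are both the given one. *)
HB.mixin Record Lmodule_isBimodule (R : comPzRingType) (A B : pzAlgType R) M
    of GRing.Lmodule R M := {
  lact : A -> M -> M;
  ract : M -> B -> M;
  lactA : forall a a' m, lact a (lact a' m) = lact (a * a') m;
  lact1 : forall m, lact 1 m = m;
  lactDr : forall a m m', lact a (m + m') = lact a m + lact a m';
  lactDl : forall a a' m, lact (a + a') m = lact a m + lact a' m;
  lactZl : forall (k : R) a m, lact (ascale k a) m = k *: lact a m;
  ractA : forall m b b', ract (ract m b) b' = ract m (b * b');
  ract1 : forall m, ract m 1 = m;
  ractDl : forall m m' b, ract (m + m') b = ract m b + ract m' b;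
  ractDr : forall m b b', ract m (b + b') = ract m b + ract m b';
  ractZr : forall (k : R) m b, ract m (ascale k b) = k *: ract m b;
  lractA : forall a m b, ract (lact a m) b = lact a (ract m b)
}.

#[short(type="bimodType")]
HB.structure Definition Bimodule (R : comPzRingType) (A B : pzAlgType R) :=
  {M of GRing.Lmodule R M & Lmodule_isBimodule R A B M}.

Notation "a *>> m" := (lact a m) (at level 40, left associativity) : ring_scope.
Notation "m <<* b" := (ract m b) (at level 40, left associativity) : ring_scope.

Section BimoduleTheory.
Variables (R : comPzRingType) (A B : pzAlgType R) (M : bimodType A B).
Implicit Types (a : A) (b : B) (m : M).

Lemma lactr0 a : a *>> (0 : M) = 0.
Proof. by apply: (addrI (a *>> 0)); rewrite -lactDr !addr0. Qed.

Lemma ract0r b : (0 : M) <<* b = 0.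
Proof. by apply: (addrI (0 <<* b)); rewrite -ractDl !addr0. Qed.

Lemma lactZr (k : R) a m : a *>> (k *: m) = k *: (a *>> m).
Proof.
rewrite -[m in LHS]lact1 -lactZl lactA -ascaleAr mulr1; exact: lactZl.
Qed.

Lemma ractZl (k : R) m b : (k *: m) <<* b = k *: (m <<* b).
Proof.
rewrite -[m in LHS]ract1 -ractZr ractA -ascaleAl mul1r; exact: ractZr.
Qed.

End BimoduleTheory.

(* Tri(A; M; B), where ((a, m), b) stands for the matrix
     ( a  m )
     ( 0  b ). *)
Section Triangular.
Variables (R : comPzRingType) (A B : pzAlgType R) (M : bimodType A B).

Definition Tri : Type := (A * M * B)%type.

HB.instance Definition _ := GRing.Zmodule.on Tri.

Implicit Types (x y z : Tri).

Definition tri_one : Tri := (1, 0, 1).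
Definition tri_mul x y : Tri :=
  (x.1.1 * y.1.1, x.1.1 *>> y.1.2 + x.1.2 <<* y.2, x.2 * y.2).
Definition tri_scale (k : R) x : Tri :=
  (ascale k x.1.1, k *: x.1.2, ascale k x.2).

Fact tri_mulA : associative tri_mul.
Proof.
move=> [[a m] b] [[a' m'] b'] [[a'' m''] b'']; rewrite /tri_mul /=.
by rewrite !mulrA lactDr ractDl lactA ractA lractA addrA.
Qed.

Fact tri_mul1r : left_id tri_one tri_mul.
Proof. by case=> [[a m] b]; rewrite /tri_mul /= !mul1r lact1 ract0r addr0. Qed.

Fact tri_mulr1 : right_id tri_one tri_mul.
Proof. by case=> [[a m] b]; rewrite /tri_mul /= !mulr1 ract1 lactr0 add0r. Qed.

Fact tri_mulDl : left_distributive tri_mul +%R.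
Proof.
move=> [[a m] b] [[a' m'] b'] [[a'' m''] b'']; rewrite /tri_mul /=.
by rewrite !mulrDl lactDl ractDl; congr (_, _, _); rewrite addrACA.
Qed.

Fact tri_mulDr : right_distributive tri_mul +%R.
Proof.
move=> [[a m] b] [[a' m'] b'] [[a'' m''] b'']; rewrite /tri_mul /=.
by rewrite !mulrDr lactDr ractDr; congr (_, _, _); rewrite addrACA.
Qed.

HB.instance Definition _ := GRing.Zmodule_isPzRing.Build Tri
  tri_mulA tri_mul1r tri_mulr1 tri_mulDl tri_mulDr.

Fact tri_scaleA j k x : tri_scale j (tri_scale k x) = tri_scale (j * k) x.
Proof. by case: x => [[a m] b]; rewrite /tri_scale /= !ascaleA scalerA. Qed.

Fact tri_scale1 x : tri_scale 1 x = x.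
Proof. by case: x => [[a m] b]; rewrite /tri_scale /= !ascale1 scale1r. Qed.

Fact tri_scaleDr k x y : tri_scale k (x + y) = tri_scale k x + tri_scale k y.
Proof. by rewrite /tri_scale /= !ascaleDr scalerDr. Qed.

Fact tri_scaleDl j k x : tri_scale (j + k) x = tri_scale j x + tri_scale k x.
Proof. by rewrite /tri_scale /= !ascaleDl scalerDl. Qed.

Fact tri_scaleAl k x y : tri_scale k (x * y) = tri_scale k x * y.
Proof.
case: x y => [[a m] b] [[a' m'] b'].
by congr (_, _, _); rewrite /= ?ascaleAl // scalerDr lactZl ractZl.
Qed.

Fact tri_scaleAr k x y : tri_scale k (x * y) = x * tri_scale k y.
Proof.
case: x y => [[a m] b] [[a' m'] b'].
by congr (_, _, _); rewrite /= ?ascaleAr // scalerDr lactZr ractZr.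
Qed.

HB.instance Definition _ := PzRing_isPzAlgebra.Build R Tri
  tri_scaleA tri_scale1 tri_scaleDr tri_scaleDl tri_scaleAl tri_scaleAr.

Definition tri_diag (e : A * B) : Tri := (e.1, 0, e.2).

End Triangular.

Section TrivialExtension.
Variables (R : comPzRingType) (S : pzAlgType R) (N : bimodType S S).

Definition triv_ext : Type := (S * N)%type.

HB.instance Definition _ := GRing.Zmodule.on triv_ext.

Implicit Types (x y z : triv_ext).

Definition triv_ext_one : triv_ext := (1, 0).
Definition triv_ext_mul x y : triv_ext :=
  (x.1 * y.1, x.1 *>> y.2 + x.2 <<* y.1).
Definition triv_ext_scale (k : R) x : triv_ext := (ascale k x.1, k *: x.2).

Fact triv_ext_mulA : associative triv_ext_mul.
Proof.
move=> [s n] [s' n'] [s'' n'']; rewrite /triv_ext_mul /=.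
by rewrite !mulrA lactDr ractDl lactA ractA lractA addrA.
Qed.

Fact triv_ext_mul1r : left_id triv_ext_one triv_ext_mul.
Proof. by case=> s n; rewrite /triv_ext_mul /= mul1r lact1 ract0r addr0. Qed.

Fact triv_ext_mulr1 : right_id triv_ext_one triv_ext_mul.
Proof. by case=> s n; rewrite /triv_ext_mul /= mulr1 ract1 lactr0 add0r. Qed.

Fact triv_ext_mulDl : left_distributive triv_ext_mul +%R.
Proof.
move=> [s n] [s' n'] [s'' n'']; rewrite /triv_ext_mul /=.
by rewrite !mulrDl lactDl ractDl; congr (_, _); rewrite addrACA.
Qed.

Fact triv_ext_mulDr : right_distributive triv_ext_mul +%R.
Proof.
move=> [s n] [s' n'] [s'' n'']; rewrite /triv_ext_mul /=.
by rewrite !mulrDr lactDr ractDr; congr (_, _); rewrite addrACA.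
Qed.

HB.instance Definition _ := GRing.Zmodule_isPzRing.Build triv_ext
  triv_ext_mulA triv_ext_mul1r triv_ext_mulr1 triv_ext_mulDl triv_ext_mulDr.

Fact triv_ext_scaleA j k x :
  triv_ext_scale j (triv_ext_scale k x) = triv_ext_scale (j * k) x.
Proof. by case: x => s n; rewrite /triv_ext_scale /= ascaleA scalerA. Qed.

Fact triv_ext_scale1 x : triv_ext_scale 1 x = x.
Proof. by case: x => s n; rewrite /triv_ext_scale /= ascale1 scale1r. Qed.

Fact triv_ext_scaleDr k x y :
  triv_ext_scale k (x + y) = triv_ext_scale k x + triv_ext_scale k y.
Proof. by rewrite /triv_ext_scale /= ascaleDr scalerDr. Qed.

Fact triv_ext_scaleDl j k x :
  triv_ext_scale (j + k) x = triv_ext_scale j x + triv_ext_scale k x.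
Proof. by rewrite /triv_ext_scale /= ascaleDl scalerDl. Qed.

Fact triv_ext_scaleAl k x y : triv_ext_scale k (x * y) = triv_ext_scale k x * y.
Proof.
case: x y => [s n] [s' n'].
by congr (_, _); rewrite /= ?ascaleAl // scalerDr lactZl ractZl.
Qed.

Fact triv_ext_scaleAr k x y : triv_ext_scale k (x * y) = x * triv_ext_scale k y.
Proof.
case: x y => [s n] [s' n'].
by congr (_, _); rewrite /= ?ascaleAr // scalerDr lactZr ractZr.
Qed.

HB.instance Definition _ := PzRing_isPzAlgebra.Build R triv_ext
  triv_ext_scaleA triv_ext_scale1 triv_ext_scaleDr triv_ext_scaleDl
  triv_ext_scaleAl triv_ext_scaleAr.

End TrivialExtension.

Definition alg_isomorphic (R : comPzRingType) (T U : pzAlgType R) : Prop :=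
  exists f : {rmorphism T -> U},
    bijective f /\ (forall (k : R) (x : T), f (ascale k x) = ascale k (f x)).

Definition has_triangular_rep (R : comPzRingType) (T : pzAlgType R) : Prop :=
  exists (A B : pzAlgType R) (M : bimodType A B),
    [/\ (1 : A) != 0, (1 : B) != 0 & alg_isomorphic T (Tri M)].

Definition idempotent_elt (A : pzRingType) (e : A) : Prop := e * e = e.

Definition nontrivial_idempotent (A : pzRingType) (e : A) : Prop :=
  [/\ idempotent_elt e, e != 0 & e != 1].

Definition only_trivial_idempotents (A : pzRingType) : Prop :=
  forall e : A, idempotent_elt e -> e = 0 \/ e = 1.

(* In the last condition e is read as the diagonal matrix diag(e_a, e_b). *)
Definition triangulating_idempotent (R : comPzRingType) (A B : pzAlgType R)
    (M : bimodType A B) (N : bimodType (Tri M) (Tri M)) (e : A * B) : Prop :=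
  nontrivial_idempotent e /\
  [/\ forall a : A, (1 - e.1) * a * e.1 = 0,
      forall b : B, (1 - e.2) * b * e.2 = 0,
      forall m : M, ((1 - e.1) *>> m) <<* e.2 = 0
    & forall n : N, ((1 - tri_diag M e) *>> n) <<* tri_diag M e = 0].

(* Main.v *)
Require Import Defs.
From HB Require Import structures.
From mathcomp Require Import all_boot all_algebra.

(** Having a triangular matrix representation is an internal property of an
algebra T: it means that T has an idempotent p, other than 0 and 1, with
(1 - p) T p = 0 (lemma [triangular_repP]).  From an isomorphism with
Tri(A; M; B) one takes for p the preimage of diag(1, 0); conversely, as the
lower left corner of the Peirce decomposition of T along p vanishes, T is
Tri(p T p; p T (1 - p); (1 - p) T (1 - p)).

For the trivial extension of S = Tri(A; M; B) by N it remains to see that p can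
be taken diagonal.  Write p = (s, n) with s = (a, m, b), and d = diag(a, b).
Then (1 - s) S s = 0 forces s = d s and d = s d ([tri_idem_absorb]).  The second
identity and 1 - d = (1 - d) (1 - s), which follows from the first, give
(1 - d) N d = (1 - d) (1 - s) N s d = 0.  They also show that d is 0 or 1 only
if s is, and then p is 0 or 1, because an idempotent of a trivial extension is
determined by its first component when that component is 0 or 1.  In the
other direction, (d, 0) is the required idempotent.

If 0 and 1 are the only idempotents of A and B, then e is (1, 0) or (0, 1), and
for e = (0, 1) the condition on M reads M = 0. *)

Set Implicit Arguments.
Unset Strict Implicit.
Unset Printing Implicit Defensive.

Import GRing.Theory.
Local Open Scope ring_scope.

Section BimoduleComplements.
Variables (R : comPzRingType) (A B : pzAlgType R) (M : bimodType A B).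

Lemma lact0l (m : M) : 0 *>> m = 0.
Proof. by apply: (addrI (0 *>> m)); rewrite -lactDl !addr0. Qed.

Lemma ractr0 (m : M) : m <<* 0 = 0.
Proof. by apply: (addrI (m <<* 0)); rewrite -ractDr !addr0. Qed.

Lemma tri_ext (x y : Tri M) :
  x.1.1 = y.1.1 -> x.1.2 = y.1.2 -> x.2 = y.2 -> x = y.
Proof. by case: x y => [[? ?] ?] [[? ?] ?] /= -> -> ->. Qed.

End BimoduleComplements.

(** * Peirce decomposition *)

(** Bundling the idempotency proof lets the structures on Peirce components be
inferred from the types alone. *)
Record idem (T : pzRingType) := Idem { ival : T; idemP : ival * ival = ival }.

Section ComplementaryIdempotent.
Variable T : pzRingType.

Fact idemC_subproof (p : idem T) : (1 - ival p) * (1 - ival p) = 1 - ival p.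
Proof. by rewrite mulrBr mulr1 mulrBl mul1r idemP subrr subr0. Qed.
Definition idemC (p : idem T) : idem T := Idem (idemC_subproof p).

Lemma idem_orthogonal (p q : idem T) :
  ival p + ival q = 1 -> ival p * ival q = 0.
Proof.
by move=> /(canRL (addKr _))->; rewrite addrC mulrBr mulr1 idemP subrr.
Qed.

End ComplementaryIdempotent.

Section PeirceComponent.
Variables (R : comPzRingType) (T : pzAlgType R) (p q : idem T).

Definition peirce_pred : {pred T} := [pred x : T | ival p * x * ival q == x].

Fact peirce_zmod_closed : zmod_closed peirce_pred.
Proof.
split=> [|x y]; first by rewrite inE mulr0 mul0r.
by rewrite !inE mulrBr mulrBl => /eqP-> /eqP->.
Qed.
HB.instance Definition _ :=
  GRing.isZmodClosed.Build T peirce_pred peirce_zmod_closed.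

Record peirce := Peirce { peirce_val : T; _ : peirce_val \in peirce_pred }.
HB.instance Definition _ := [isSub for peirce_val].
HB.instance Definition _ := [Choice of peirce by <:].
HB.instance Definition _ := [SubChoice_isSubZmodule of peirce by <:].

Lemma peirce_l (x : peirce) : ival p * val x = val x.
Proof. by have /eqP<- := valP x; rewrite !mulrA idemP. Qed.

Lemma peirce_r (x : peirce) : val x * ival q = val x.
Proof. by have /eqP<- := valP x; rewrite -!mulrA idemP. Qed.

Fact peirce_proj_subproof (x : T) : ival p * x * ival q \in peirce_pred.
Proof. by rewrite inE !mulrA idemP -!mulrA idemP. Qed.
Definition peirce_proj (x : T) : peirce := Peirce (peirce_proj_subproof x).

Lemma peirce_projB : {morph peirce_proj : x y / x - y}.
Proof. by move=> x y; apply: val_inj; rewrite /= mulrBr mulrBl. Qed.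

Fact peirce_scale_subproof k (x : peirce) : ascale k (val x) \in peirce_pred.
Proof. by rewrite inE -ascaleAr -ascaleAl peirce_l peirce_r. Qed.
Definition peirce_scale k (x : peirce) : peirce :=
  Peirce (peirce_scale_subproof k x).

Fact peirce_scaleA j k x :
  peirce_scale j (peirce_scale k x) = peirce_scale (j * k) x.
Proof. by apply: val_inj; rewrite /= ascaleA. Qed.

Fact peirce_scale1 : left_id 1 peirce_scale.
Proof. by move=> x; apply: val_inj; rewrite /= ascale1. Qed.

Fact peirce_scaleDr : right_distributive peirce_scale +%R.
Proof. by move=> k x y; apply: val_inj; rewrite /= ascaleDr. Qed.

Fact peirce_scaleDl x : {morph peirce_scale^~ x : j k / j + k}.
Proof. by move=> j k; apply: val_inj; rewrite /= ascaleDl. Qed.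

HB.instance Definition _ := GRing.Zmodule_isLmodule.Build R peirce
  peirce_scaleA peirce_scale1 peirce_scaleDr peirce_scaleDl.

End PeirceComponent.

(** The products of Peirce components compose like morphisms, with idempotents
as objects.  Proved in this generality, their laws give at once the ring
structure of p T p and both actions on p T q. *)
Section PeirceProduct.
Variables (R : comPzRingType) (T : pzAlgType R).

Fact peirce_mul_subproof (p q r : idem T) (x : peirce p q) (y : peirce q r) :
  val x * val y \in peirce_pred p r.
Proof. by rewrite inE mulrA peirce_l -mulrA peirce_r. Qed.
Definition peirce_mul (p q r : idem T) (x : peirce p q) (y : peirce q r) :=
  Peirce (peirce_mul_subproof x y).

Lemma peirce_mulA (p q r s : idem T)
    (x : peirce p q) (y : peirce q r) (z : peirce r s) :
  peirce_mul x (peirce_mul y z) = peirce_mul (peirce_mul x y) z.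
Proof. by apply: val_inj; rewrite /= mulrA. Qed.

Lemma peirce_mulDl (p q r : idem T) (x x' : peirce p q) (y : peirce q r) :
  peirce_mul (x + x') y = peirce_mul x y + peirce_mul x' y.
Proof. by apply: val_inj; rewrite /= mulrDl. Qed.

Lemma peirce_mulDr (p q r : idem T) (x : peirce p q) (y y' : peirce q r) :
  peirce_mul x (y + y') = peirce_mul x y + peirce_mul x y'.
Proof. by apply: val_inj; rewrite /= mulrDr. Qed.

Lemma peirce_mulZl (p q r : idem T) k (x : peirce p q) (y : peirce q r) :
  peirce_mul (k *: x) y = k *: peirce_mul x y.
Proof. by apply: val_inj; rewrite /= ascaleAl. Qed.

Lemma peirce_mulZr (p q r : idem T) k (x : peirce p q) (y : peirce q r) :
  peirce_mul x (k *: y) = k *: peirce_mul x y.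
Proof. by apply: val_inj; rewrite /= ascaleAr. Qed.

Fact peirce_one_subproof (p : idem T) : ival p \in peirce_pred p p.
Proof. by rewrite inE !idemP. Qed.
Definition peirce_one (p : idem T) : peirce p p :=
  Peirce (peirce_one_subproof p).

Lemma peirce_mul1 (p q : idem T) (x : peirce p q) :
  peirce_mul (peirce_one p) x = x.
Proof. by apply: val_inj; rewrite /= peirce_l. Qed.

Lemma peirce_mulr1 (p q : idem T) (x : peirce p q) :
  peirce_mul x (peirce_one q) = x.
Proof. by apply: val_inj; rewrite /= peirce_r. Qed.

End PeirceProduct.

(** A separate name for the diagonal components, so that their algebra structure
is not searched for on the off-diagonal ones. *)
Definition corner (R : comPzRingType) (T : pzAlgType R) (p : idem T) : Type :=
  peirce p p.

Section CornerAlgebra.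
Variables (R : comPzRingType) (T : pzAlgType R) (p : idem T).

HB.instance Definition _ := GRing.Zmodule.on (corner p).
HB.instance Definition _ := GRing.Zmodule_isPzRing.Build (corner p)
  (@peirce_mulA R T p p p p) (@peirce_mul1 R T p p) (@peirce_mulr1 R T p p)
  (@peirce_mulDl R T p p p) (@peirce_mulDr R T p p p).
HB.instance Definition _ := PzRing_isPzAlgebra.Build R (corner p)
  (@peirce_scaleA R T p p) (@peirce_scale1 R T p p)
  (@peirce_scaleDr R T p p) (fun j k x => @peirce_scaleDl R T p p x j k)
  (fun k x y => esym (@peirce_mulZl R T p p p k x y))
  (fun k x y => esym (@peirce_mulZr R T p p p k x y)).

End CornerAlgebra.

Section PeirceBimodule.
Variables (R : comPzRingType) (T : pzAlgType R) (p q : idem T).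

HB.instance Definition _ :=
  Lmodule_isBimodule.Build R (corner p) (corner q) (peirce p q)
    (@peirce_mulA R T p p p q) (@peirce_mul1 R T p q)
    (@peirce_mulDr R T p p q) (@peirce_mulDl R T p p q)
    (@peirce_mulZl R T p p q)
    (fun x y z => esym (@peirce_mulA R T p q q q x y z))
    (@peirce_mulr1 R T p q)
    (@peirce_mulDl R T p q q) (@peirce_mulDr R T p q q)
    (fun k x y => @peirce_mulZr R T p q q k x y)
    (fun x y z => esym (@peirce_mulA R T p p q q x y z)).

End PeirceBimodule.

(** * Triangular representations and idempotents *)

Section TriangularRepresentation.
Variables (R : comPzRingType) (T : pzAlgType R).

(** The complement of p is a variable q with p + q = 1, so that simplification
does not unfold it to 1 - p and both idempotents play symmetric roles. *)
Section FromIdempotent.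
Variables P Q : idem T.
Local Notation p := (ival P).
Local Notation q := (ival Q).
Hypotheses (pDq : p + q = 1) (lower0 : forall x : T, q * x * p = 0).

Let pq0 : p * q = 0. Proof. exact: idem_orthogonal. Qed.
Let qp0 : q * p = 0. Proof. by apply: idem_orthogonal; rewrite addrC. Qed.

Let U := Tri (peirce P Q).

Definition peirce_tri (x : T) : U :=
  (peirce_proj P P x : corner P, peirce_proj P Q x,
   peirce_proj Q Q x : corner Q).

Definition peirce_sum (u : U) : T := val u.1.1 + val u.1.2 + val u.2.

Lemma peirce_triB : {morph peirce_tri : x y / x - y}.
Proof. by move=> x y; rewrite /peirce_tri !peirce_projB. Qed.

Lemma lower_absorb (x : T) : q * x * q = q * x.
Proof. by rewrite -[RHS]mulr1 -pDq mulrDr lower0 add0r. Qed.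

Lemma upper_absorb (x : T) : p * x * p = x * p.
Proof.
by rewrite -[x in RHS]mul1r -pDq !mulrDl lower0 addr0.
Qed.

(** Inserting 1 = p + q between the factors of x y yields the matrix product
plus terms through q T p, which vanish. *)
Lemma peirce_tri_is_monoid_morphism : monoid_morphism peirce_tri.
Proof.
split=> [|x y].
  by apply: tri_ext; apply: val_inj; rewrite /= mulr1 ?idemP ?pq0.
apply: tri_ext; apply: val_inj => /=.
- rewrite !mulrA -(mulrA _ p p) idemP -!mulrA [p * (y * _)]mulrA.
  by rewrite upper_absorb.
- rewrite -!mulrA (mulrA p p) (mulrA q q) !idemP -!mulrDr -mulrDl pDq.
  by rewrite mul1r.
- by rewrite !mulrA -(mulrA _ q q) idemP lower_absorb.
Qed.

Lemma peirce_triK : cancel peirce_tri peirce_sum.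
Proof.
move=> x; rewrite /peirce_sum /= lower_absorb -mulrDr pDq.
by rewrite mulr1 -mulrDl pDq mul1r.
Qed.

Lemma peirce_sumK : cancel peirce_sum peirce_tri.
Proof.
case=> [[a m] b]; rewrite /peirce_sum /=.
have qa : q * val a = 0 by rewrite -peirce_l mulrA qp0 mul0r.
have aq : val a * q = 0 by rewrite -peirce_r -mulrA pq0 mulr0.
have mp : val m * p = 0 by rewrite -peirce_r -mulrA qp0 mulr0.
have qm : q * val m = 0 by rewrite -peirce_l mulrA qp0 mul0r.
have pb : p * val b = 0 by rewrite -peirce_l mulrA pq0 mul0r.
apply: tri_ext; apply: val_inj; rewrite /= !mulrDr !mulrDl.
- by rewrite !peirce_l peirce_r pb mp mul0r !addr0.
- by rewrite !peirce_l peirce_r pb aq mul0r addr0 add0r.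
- by rewrite qa qm peirce_l peirce_r !mul0r !add0r.
Qed.

Lemma peirce_triZ k x : peirce_tri (ascale k x) = ascale k (peirce_tri x).
Proof.
by apply: tri_ext; apply: val_inj; rewrite /= -ascaleAr -ascaleAl.
Qed.

Lemma alg_isomorphic_peirce : alg_isomorphic T U.
Proof.
pose f : {rmorphism T -> U} := HB.pack peirce_tri
  (GRing.isZmodMorphism.Build T U peirce_tri peirce_triB)
  (GRing.isMonoidMorphism.Build T U peirce_tri peirce_tri_is_monoid_morphism).
exists f; split; last exact: peirce_triZ.
by exists peirce_sum; [exact: peirce_triK | exact: peirce_sumK].
Qed.

End FromIdempotent.

(** In both directions the unit of one diagonal algebra corresponds to p and the
unit of the other to 1 - p, so these algebras are nonzero exactly when p is
neither 0 nor 1. *)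
Lemma triangular_repP :
  has_triangular_rep T <->
  exists2 p : T, nontrivial_idempotent p & forall x, (1 - p) * x * p = 0.
Proof.
split=> [[A [B [M [A1 B1 [f [[g fK gK] _]]]]]] | [p [pp p0 p1] lower0]].
- pose e : Tri M := (1, 0, 0).
  have ee : e * e = e.
    rewrite /e; apply: tri_ext; rewrite /= ?mulr1 ?mulr0 //.
    by rewrite lactr0 ractr0 addr0.
  have fge : f (g e) = e := gK e.
  exists (g e) => [|x]; last first.
    apply: (can_inj fK); rewrite !rmorphM rmorphB rmorph1 fge rmorph0.
    case: (f x) => [[a m] b]; apply: tri_ext => /=.
    + by rewrite subrr !mul0r.
    + by rewrite lactr0 ractr0 addr0.
    + by rewrite mulr0.
  split; first by apply: (can_inj fK); rewrite rmorphM fge.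
  + apply: contraNneq A1 => ge0; move: fge; rewrite ge0 rmorph0.
    by case=> <-.
  + apply: contraNneq B1 => ge1; move: fge; rewrite ge1 rmorph1.
    by case=> ->.
- pose P := Idem pp.
  exists (corner P), (corner (idemC P)), (peirce P (idemC P)); split.
  + by apply: contraNneq p0 => /(congr1 val)/= ->.
  + apply: contraNneq p1 => /(congr1 val)/eqP.
    by rewrite /= subr_eq0 eq_sym.
  + by apply: alg_isomorphic_peirce => //=; rewrite addrC subrK.
Qed.

End TriangularRepresentation.

(** * Idempotents of a trivial extension *)

Section TriangularIdempotent.
Variables (R : comPzRingType) (A B : pzAlgType R) (M : bimodType A B).

Lemma tri_diag_lower0 (e : A * B) :
    (forall a, (1 - e.1) * a * e.1 = 0) ->
    (forall b, (1 - e.2) * b * e.2 = 0) ->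
    (forall m : M, ((1 - e.1) *>> m) <<* e.2 = 0) ->
  forall s : Tri M, (1 - tri_diag M e) * s * tri_diag M e = 0.
Proof.
move=> ha hb hm [[a m] b]; apply: tri_ext => /=; rewrite ?ha ?hb //.
by rewrite lactr0 subr0 ract0r addr0 add0r hm.
Qed.

Lemma tri_lower0 (a : A) (m : M) (b : B) :
    let s : Tri M := (a, m, b) in (forall x, (1 - s) * x * s = 0) ->
  [/\ forall x, (1 - a) * x * a = 0, forall x, (1 - b) * x * b = 0
    & forall x : M, ((1 - a) *>> x) <<* b = 0].
Proof.
move=> s lower0; split=> x.
- by have [] := lower0 (x, 0, 0).
- by have [] := lower0 (0, 0, x).
- have [_ + _] := lower0 (0, x, 0) => /=.
  by rewrite mulr0 lact0l add0r ractr0 addr0.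
Qed.

(** The entry m of the idempotent satisfies m = a m + m b, while
m b = a m b + (1 - a) m b = 0; hence m = a m and m b = 0. *)
Lemma tri_idem_absorb (a : A) (m : M) (b : B) :
    let s : Tri M := (a, m, b) in let d := tri_diag M (a, b) in
    idempotent_elt s -> ((1 - a) *>> m) <<* b = 0 ->
  s = d * s /\ d = s * d.
Proof.
move=> s d; rewrite /idempotent_elt /s /d => -[aa mm bb] upper0.
have amb : a *>> (m <<* b) = 0.
  have := congr1 (lact a) mm.
  by rewrite /= lactDr lactA aa => /(canRL (addKr _)); rewrite addNr.
have mb : m <<* b = 0.
  rewrite -[m in LHS]lact1 -[X in X *>> _](subrK a) lactDl ractDl.
  by rewrite upper0 add0r lractA.
split; apply: tri_ext; rewrite /= ?aa ?bb ?lactr0 ?add0r ?mb //.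
by rewrite ract0r addr0 -[in LHS]mm mb addr0.
Qed.

End TriangularIdempotent.

Section TrivialExtensionIdempotent.
Variables (R : comPzRingType) (S : pzAlgType R) (N : bimodType S S).

Lemma triv_ext_idem_eq0 (n : N) :
  idempotent_elt ((0, n) : triv_ext N) -> n = 0.
Proof. by case=> _; rewrite /= lact0l ractr0 addr0. Qed.

Lemma triv_ext_idem_eq1 (n : N) :
  idempotent_elt ((1, n) : triv_ext N) -> n = 0.
Proof.
by case=> _; rewrite /= lact1 ract1 => /(canRL (addKr _)); rewrite addNr.
Qed.

Lemma triv_ext_lower0 (s : S) (n0 : N) :
    let p : triv_ext N := (s, n0) in (forall x, (1 - p) * x * p = 0) ->
  (forall x : S, (1 - s) * x * s = 0) /\
  (forall n : N, ((1 - s) *>> n) <<* s = 0).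
Proof.
move=> p lower0; split=> x; first by have [] := lower0 (x, 0).
have [_] := lower0 (0, x) => /=.
by rewrite mulr0 lact0l add0r ractr0 addr0.
Qed.

End TrivialExtensionIdempotent.

(* The last assertion fails for M = 0: then (0, 1) may also satisfy (2), e.g.
   when N = 0. *)
Theorem corollary2p3 (R : comPzRingType) (A B : pzAlgType R)
    (M : bimodType A B) (N : bimodType (Tri M) (Tri M)) :
  (has_triangular_rep (triv_ext N) <->
     exists e : A * B, triangulating_idempotent N e) /\
  (only_trivial_idempotents A -> only_trivial_idempotents B ->
     (exists m : M, m != 0) ->
     forall e : A * B, triangulating_idempotent N e -> e = (1, 0)).
Proof.
split; last first.
  move=> trivA trivB [m m0] [ea eb] [[ee e0 e1] [_ _ upper0 _]].
  case: ee => /trivA eaE /trivB ebE; move: e0 e1 upper0.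
  case: eaE => ->; case: ebE => -> //=; rewrite ?eqxx // => _ _ /(_ m).
  by rewrite subr0 lact1 ract1 => mE; rewrite mE eqxx in m0.
split=> [/triangular_repP[[[[a m] b] n] [pp p0 p1] /triv_ext_lower0[]] |].
- set s : Tri M := (a, m, b) => lowerS lowerN.
  have ss : idempotent_elt s := congr1 fst pp.
  have [hA hB hM] := tri_lower0 lowerS.
  have [sE dE] := tri_idem_absorb ss (hM m).
  set d := tri_diag M (a, b) in sE dE.
  have [aa _ bb] := ss.
  rewrite -/s in pp p0 p1 sE dE; clearbody s.
  exists (a, b); split; first split.
  + exact: injective_projections.
  + apply: contraNneq p0 => -[a0 b0].
    have s0 : s = 0 by rewrite sE /d a0 b0 mul0r.
    by rewrite s0 in pp *; rewrite (triv_ext_idem_eq0 pp).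
  + apply: contraNneq p1 => -[a1 b1].
    have d1 : d = 1 by rewrite /d a1 b1.
    have s1 : s = 1 by rewrite -[s]mulr1 -{1}d1 -dE d1.
    by rewrite s1 in pp *; rewrite (triv_ext_idem_eq1 pp).
  + split=> //= x; have dC : 1 - d = (1 - d) * (1 - s).
      by rewrite mulrBr mulr1 mulrBl mul1r -sE subrr subr0.
    (* the idempotent s, for which (1 - s) N s = 0 is known, is inserted on
       both sides of x *)
    by rewrite -/d dC {2}dE -lactA -ractA lractA lowerN lactr0 ract0r.
- move=> [[ea eb] [[ee e0 e1] [hA hB hM hN]]]; set d := tri_diag M _ in hN.
  have dd : d * d = d.
    case: ee => eea eeb; apply: tri_ext; rewrite /= ?eea ?eeb //.
    by rewrite lactr0 ract0r addr0.
  apply/triangular_repP; exists (d, 0) => [|[s n]].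
    split.
    + by apply: injective_projections; rewrite /= ?dd // lactr0 ract0r addr0.
    + by apply: contraNneq e0 => -[-> ->].
    + by apply: contraNneq e1 => -[-> ->].
  apply: injective_projections => /=; first exact: tri_diag_lower0.
  by rewrite lactr0 subr0 ract0r addr0 add0r hN.
Qed.
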